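(* Let $L$ be a set, $\star:L\times L\to\{0,1\}$ a map, and $\mathcal{C}$ a class of $L$-labelled graphs. Let $\widetilde{\mathcal{C}_\star}_{<\omega}$ denote the class of $L$-labelled graphs which are lexicographical sums, indexed by finite chains, of members of $\mathcal{C}$. Then: (1) if $\mathcal{C}$ is a hereditary class of finite $L$-labelled graphs, then $\widetilde{\mathcal{C}_\star}_{<\omega}$ is hereditary; (2) if $\mathcal{C}$ is an inexhaustible age of $L$-labelled graphs, then $\widetilde{\mathcal{C}_\star}_{<\omega}$ is an inexhaustible age; (3) if $\mathcal{C}$ is well-quasi-ordered under embeddability, then so is $\widetilde{\mathcal{C}_\star}_{<\omega}$; (4) if there is a bound $k$ such that every member of $\mathcal{C}$ is a direct sum of labelled paths of length at most $k$, then the lengths of the labelled paths belonging to $\widetilde{\mathcal{C}_\star}_{<\omega}$ are bounded.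
   Context: An $L$-labelled graph is a pair $(G,\ell)$ with $G$ a simple loopless undirected graph and $\ell:V(G)\to L$. $(G,\ell)$ embeds into $(G',\ell')$ if there is an isomorphism $h$ of $G$ onto an induced subgraph of $G'$ with $\ell'(h(v))=\ell(v)$. A class is hereditary if it is closed under embeddability (taking induced labelled subgraphs up to isomorphism). The age of a labelled graph is the class of finite labelled graphs embedding into it; a class is an age iff it is hereditary and up-directed; an age is inexhaustible if any two of its members embed disjointly in a third. Well-quasi-ordered means no infinite antichain and no infinite strictly descending sequence. Given a chain $C=(I,\le)$ and labelled graphs $(G_i,\ell_i)_{i\in I}$ with pairwise disjoint vertex sets, the lexicographical sum $\sum_{\star i\in C}(G_i,\ell_i)$ is the labelled graph on $\bigcup_i V(G_i)$, labelled by the $\ell_i$, whose edges are those of the $G_i$ together with the pairs $\{x_i,x_j\}$ with $i<j$, $x_i\in V(G_i)$, $x_j\in V(G_j)$ and $\ell_i(x_i)\star\ell_j(x_j)=1$. A path is a graph whose vertices can be injectively mapped into an interval of $\mathbb{Z}$ so that adjacency means images differing by $1$; its length is its number of vertices minus one. The direct sum of graphs is their disjoint union with no edges between them.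
   Formalization: Part (4) is proved under the added assumption that only finitely many labels occur in members of C; without it (4) fails, e.g. L = ℕ, a⋆b = 1 iff b = a+1, C the one-vertex graphs, whose finite sums include paths of every length. *)

(* Defs.v *)
From HB Require Import structures.
From mathcomp Require Import all_boot all_order all_algebra.
From mathcomp Require Import boolp classical_sets cardinality.

Set Implicit Arguments.
Unset Strict Implicit.
Unset Printing Implicit Defensive.

Import Order.TTheory GRing.Theory Num.Theory.

Local Open Scope classical_set_scope.
Local Open Scope card_scope.
Local Open Scope ring_scope.

(* Classes of labelled graphs are predicates [lgraph L -> Prop], not elements of
   [set (lgraph L)], and chains are explicit relations, not [orderType]s: each
   of these alternatives ties the universe of [graph] to those of the MathComp
   structures, and the two together are inconsistent. *)
Record graph : Type := Graph {
  vertex :> Type;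
  edge : vertex -> vertex -> Prop;
  edge_sym : forall x y, edge x y -> edge y x;
  edge_irrefl : forall x, ~ edge x x
}.

Record lgraph (L : Type) : Type := LGraph {
  underlying :> graph;
  label : underlying -> L
}.

Definition finite_graph (G : graph) : Prop := finite_set [set: G].

Section Embeddability.
Variable L : Type.
Implicit Types (G H : lgraph L) (C : lgraph L -> Prop).

Definition embedding G H (h : G -> H) : Prop :=
  [/\ injective h,
      forall x y : G, edge x y <-> edge (h x) (h y)
    & forall x : G, label (h x) = label x].

Definition embeds G H : Prop := exists h : G -> H, embedding h.

Definition isomorphic G H : Prop :=
  exists h : G -> H, bijective h /\ embedding h.

Definition hereditary C : Prop :=
  forall G H, C H -> embeds G H -> C G.

Definition age H : lgraph L -> Prop :=
  fun G => finite_graph G /\ embeds G H.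

Definition is_age C : Prop := exists H, forall G, C G <-> age H G.

Definition inexhaustible C : Prop :=
  forall G1 G2, C G1 -> C G2 ->
  exists (H : lgraph L) (h1 : G1 -> H) (h2 : G2 -> H),
    [/\ C H, embedding h1, embedding h2 & forall x y, h1 x <> h2 y].

Definition antichain_seq (u : nat -> lgraph L) : Prop :=
  forall m n, m <> n -> ~ embeds (u m) (u n).

Definition strictly_descending (u : nat -> lgraph L) : Prop :=
  forall n, embeds (u n.+1) (u n) /\ ~ embeds (u n) (u n.+1).

Definition wqo C : Prop :=
  (~ exists u : nat -> lgraph L, (forall n, C (u n)) /\ antichain_seq u) /\
  (~ exists u : nat -> lgraph L, (forall n, C (u n)) /\ strictly_descending u).

(* Finiteness of this set is what bounds the lengths of the paths that are
   lexicographical sums: with L = nat and star a b = (b == a.+1), summing one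
   vertex of each label 0, ..., n in this order gives a path of length n. *)
Definition labels_of C : set L :=
  [set a | exists (G : lgraph L) (x : G), C G /\ label x = a].

End Embeddability.

Definition is_chain (I : Type) (le : rel I) : Prop :=
  [/\ reflexive le, antisymmetric le, transitive le & total le].

Section LexicographicalSum.
Variables (L : Type) (star : L -> L -> bool).
Variables (I : Type) (le : rel I) (G : I -> lgraph L).

Definition lexsum_vertex : Type := {i : I & G i}.

Definition lexsum_label (u : lexsum_vertex) : L := label (projT2 u).

Inductive lexsum_edge : lexsum_vertex -> lexsum_vertex -> Prop :=
| lexsum_in i (x y : G i) of edge x y :
    lexsum_edge (existT _ i x) (existT _ i y)
| lexsum_lt i j (x : G i) (y : G j)
    of le i j & i <> j & star (label x) (label y) = true :
    lexsum_edge (existT _ i x) (existT _ j y)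
| lexsum_gt i j (x : G i) (y : G j)
    of le i j & i <> j & star (label x) (label y) = true :
    lexsum_edge (existT _ j y) (existT _ i x).

Lemma lexsum_edge_sym u v : lexsum_edge u v -> lexsum_edge v u.
Proof.
case=> [i x y /edge_sym xy|i j x y ij neq xy|i j x y ij neq xy].
- exact: lexsum_in.
- exact: lexsum_gt.
- exact: lexsum_lt.
Qed.

Lemma lexsum_edge_irrefl u : ~ lexsum_edge u u.
Proof.
move=> uu; suff irr v w : lexsum_edge v w -> v = w -> False by exact: irr uu _.
case=> [i x y xy|i j x y _ neq _|i j x y _ neq _] e.
- have exy : x = y.
    by move: (projT2_eq e); rewrite (Prop_irrelevance (projT1_eq e) erefl).
  by move: xy; rewrite exy; apply: edge_irrefl.
- by apply: neq; have := projT1_eq e.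
- by apply: neq; have := projT1_eq e.
Qed.

Definition lexsum : lgraph L :=
  @LGraph L (Graph lexsum_edge_sym lexsum_edge_irrefl) lexsum_label.

End LexicographicalSum.

(* Up to isomorphism: [lexsum_vertex] makes the vertex sets of the summands
   disjoint. The finite chain may be empty, the sum being then the empty
   graph. *)
Definition finite_lexsums (L : Type) (star : L -> L -> bool)
    (C : lgraph L -> Prop) : lgraph L -> Prop :=
  fun H => exists (I : Type) (le : rel I) (G : I -> lgraph L),
    [/\ finite_set [set: I], is_chain le, forall i, C (G i)
      & isomorphic H (lexsum star le G)].

Section DirectSum.
Variables (L I : Type) (G : I -> lgraph L).

Definition dsum_vertex : Type := {i : I & G i}.

Definition dsum_label (u : dsum_vertex) : L := label (projT2 u).

Inductive dsum_edge : dsum_vertex -> dsum_vertex -> Prop :=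
| dsum_in i (x y : G i) of edge x y : dsum_edge (existT _ i x) (existT _ i y).

Lemma dsum_edge_sym u v : dsum_edge u v -> dsum_edge v u.
Proof. by case=> i x y /edge_sym xy; constructor. Qed.

Lemma dsum_edge_irrefl u : ~ dsum_edge u u.
Proof.
move=> uu; suff irr v w : dsum_edge v w -> v = w -> False by exact: irr uu _.
case=> i x y xy e; have exy : x = y.
  by move: (projT2_eq e); rewrite (Prop_irrelevance (projT1_eq e) erefl).
by move: xy; rewrite exy; apply: edge_irrefl.
Qed.

Definition dsum : lgraph L :=
  @LGraph L (Graph dsum_edge_sym dsum_edge_irrefl) dsum_label.

End DirectSum.

(* The map is required to be onto the interval: otherwise edgeless graphs
   would be paths. *)
Definition is_path (P : graph) : Prop :=
  exists (J : interval int) (f : P -> int),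
    [/\ injective f, range f = [set` J]
      & forall x y : P, edge x y <-> `|f x - f y| = 1].

(* The length of a path is its number of vertices minus one, so an infinite
   path satisfies this for no k (and the empty path for every k). *)
Definition length_at_most (P : graph) (k : nat) : Prop :=
  [set: P] #<= `I_k.+1.

Definition dsum_of_paths (L : Type) (k : nat) (H : lgraph L) : Prop :=
  exists (I : Type) (P : I -> lgraph L),
    (forall i, is_path (P i) /\ length_at_most (P i) k) /\
    isomorphic H (dsum P).

(* Main.v *)
Require Import Defs.
From mathcomp Require Import all_boot all_order all_algebra.
From mathcomp Require Import boolp classical_sets functions cardinality.
From mathcomp Require Import zify.

(* A map c from the vertices of a graph to a chain such that edges between
   different fibres are governed by labels presents the graph as the
   lexicographical sum of its fibres; this gives (1), and (2) with the sum of
   omega copies of a graph whose age is C. A finite lexicographical sum is a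
   word over C and subwords give embeddings, so (3) is Higman's theorem.

   For (4), an edge of a path in a sum is either inside a summand or crosses
   between two of them. Among k+1 consecutive edges one crosses, as otherwise
   k+2 vertices would lie in one component of a summand. Three crossing edges
   with the same direction and the same labels at their ends cannot occur: the
   lowest of the three lower ends would be adjacent to the three upper ends,
   while a path has degree at most 2. With finitely many labels, pigeonhole
   bounds the length. *)

Set Implicit Arguments.
Unset Strict Implicit.
Unset Printing Implicit Defensive.

Import Order.TTheory GRing.Theory Num.Theory.

Local Open Scope classical_set_scope.
Local Open Scope card_scope.

(** * Sequences and Higman's theorem *)

Lemma dependent_choice (r : nat -> nat -> Prop) (m : nat) :
  (forall i, exists j, r i j) ->
  exists s : nat -> nat, s 0 = m /\ forall i, r (s i) (s i.+1).
Proof.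
move=> /choice[g rg]; exists (fun i => iter i g m).
by split=> // i; apply: rg.
Qed.

(** Call an index terminal if [r] relates it to no later one. Either no index from some [N] on is
    terminal, and one can step along [r] forever, or there are infinitely many terminal indices, and
    these give the second alternative. *)
Lemma sequence_dichotomy (r : nat -> nat -> Prop) :
  exists s : nat -> nat, {homo s : i j / i < j} /\
    ((forall i, r (s i) (s i.+1)) \/ (forall i j, i < j -> ~ r (s i) (s j))).
Proof.
pose terminal m := forall n, m < n -> ~ r m n.
have [[N nterm]|term] := pselect (exists N, forall m, N <= m -> ~ terminal m).
  (* The guard [N <= m] gives every index a successor, as choice requires; a sequence started at [N]
     always satisfies the guard. *)
  have [|s [s0 rs]] := @dependent_choice
    (fun m n => m < n /\ (N <= m -> r m n)) N.
    move=> m; have [Nm|_] := leqP N m; last by exists m.+1.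
    have /existsNP[n /not_implyP[mn /contrapT rmn]] := nterm _ Nm.
    by exists n.
  have sN i : N <= s i.
    elim: i => [|i IHi]; first by rewrite s0.
    by rewrite (leq_trans IHi) // ltnW //; case: (rs i).
  exists s; split.
    by apply: homo_ltn => [|i]; [exact: ltn_trans|case: (rs i)].
  by left=> i; case: (rs i) => _; apply.
have [|s [_ rs]] := @dependent_choice (fun m n => m < n /\ terminal n) 0.
  move=> m; have /existsNP[n /not_implyP[mn /contrapT tn]] :=
    (forallNP (fun N => forall m, N <= m -> ~ terminal m)).2 term m.+1.
  by exists n.
have s_mono : {homo s : i j / i < j}.
  by apply: homo_ltn => [|i]; [exact: ltn_trans|case: (rs i)].
(* Only the values [s i.+1] are known to be terminal, so [s 0] is dropped. *)
exists (s \o succn); split=> [i j ij /=|]; first exact: s_mono.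
by right=> i j ij; case: (rs i) => _; apply; apply: s_mono.
Qed.

Section Higman.
Variables (A : Type) (R : A -> A -> Prop).

(** Higman's argument uses well-quasi-ordering in the form that all sequences are good; [wqo_good]
    and [good_wqo] translate. *)
Definition good_seq T (r : T -> T -> Prop) (u : nat -> T) : Prop :=
  exists i j, i < j /\ r (u i) (u j).

Inductive subword : seq A -> seq A -> Prop :=
| subword_nil t : subword [::] t
| subword_skip s y t of subword s t : subword s (y :: t)
| subword_cons x s y t of R x y & subword s t : subword (x :: s) (y :: t).

(** [f] increases strictly on all of nat, not only below [size s], so that it can later serve as an
    order embedding. *)
Lemma subword_map_nth s t : subword s t ->
  exists f : nat -> nat, {homo f : i j / i < j} /\
    forall i, i < size s -> f i < size t /\
      forall x y, R (nth x s i) (nth y t (f i)).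
Proof.
elim=> {s t} [t|s y t _ [f [f_mono fP]]|x s y t xy _ [f [f_mono fP]]].
- by exists (fun i => i); split.
- exists (fun i => (f i).+1); split=> [i j|i /fP[]] //.
  by rewrite ltnS; apply: f_mono.
- exists (fun i => if i is i'.+1 then (f i').+1 else 0); split.
    by case=> [|i] [|j] //; rewrite !ltnS; apply: f_mono.
  by case=> [|i] //= /fP[].
Qed.

Hypothesis R_trans : forall y x z, R x y -> R y z -> R x z.
Hypothesis R_good : forall u, good_seq R u.

Lemma monotone_subseq (u : nat -> A) :
  exists s : nat -> nat, {homo s : i j / i < j} /\
    forall i j, i < j -> R (u (s i)) (u (s j)).
Proof.
have [s [s_mono [rs|Nrs]]] := sequence_dichotomy (fun i j => R (u i) (u j)).
  exists s; split=> // i j.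
  by apply: (@homo_ltn _ (u \o s) R) => [|k]; [exact: R_trans|exact: rs].
by have [i [j [/Nrs nr r]]] := R_good (u \o s).
Qed.

(* Nash-Williams: [F n.+1] is a bad sequence that agrees with [F n] below [n]
   and whose [n]th word is as short as possible; the diagonal is then a
   minimal bad sequence, which deleting first letters would shorten. *)
Lemma higman (w : nat -> seq A) : good_seq subword w.
Proof.
pose bad u := ~ good_seq subword u.
apply: contrapT => bad_w.
(* [bad u] is assumed under the existential, so that choice yields [next] on every sequence. *)
have step (n : nat) (u : nat -> seq A) : exists v, bad u ->
    [/\ bad v, forall i, i < n -> v i = u i
      & forall v', bad v' -> (forall i, i < n -> v' i = u i) ->
          size (v n) <= size (v' n)].
  have [bad_u|good_u] := pselect (bad u); last by exists u.
  pose len m := `[< exists v, [/\ bad v, forall i, i < n -> v i = u i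
                              & size (v n) = m] >].
  have len_ex : exists m, len m by exists (size (u n)); apply/asboolP; exists u.
  have [m /asboolP[v [bad_v vu sz_v]] m_min] := find_ex_minn len_ex.
  exists v => _; split=> // v' bad_v' v'u; rewrite sz_v; apply: m_min.
  by apply/asboolP; exists v'.
have [next nextP] := choice (fun p : nat * (nat -> seq A) => step p.1 p.2).
pose F := fix F n := if n is m.+1 then next (m, F m) else w.
have bad_F n : bad (F n).
  by elim: n => [|n IHn] //=; case: (nextP (n, F n) IHn).
have F_agree n d i : i < n -> F (n + d) i = F n i.
  elim: d => [|d IHd] lin; first by rewrite addn0.
  rewrite addnS -IHd //=.
  case: (nextP (n + d, F (n + d)) (bad_F _)) => _ agree _.
  by apply: agree; apply: ltn_addr.
pose f n := F n.+1 n.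
have fE m n : n < m -> F m n = f n.
  by move=> nm; rewrite -(subnKC nm) F_agree.
have bad_f : bad f.
  move=> [i [j [ij fij]]]; apply: (bad_F j.+1); exists i, j; split=> //.
  by rewrite fE // ltnS ltnW.
have f_min n v : bad v -> (forall i, i < n -> v i = f i) ->
    size (f n) <= size (v n).
  move=> bad_v vf; case: (nextP (n, F n) (bad_F n)) => _ _; apply=> //= i lin.
  by rewrite vf // fE.
have f_cons n : exists p : A * seq A, f n = p.1 :: p.2.
  case E : (f n) => [|a t]; last by exists (a, t).
  case: bad_f; exists n, n.+1; split=> //; rewrite E; exact: subword_nil.
have [p pE] := choice f_cons.
have [s [s_mono Rs]] := monotone_subseq (fun n => (p n).1).
(* Below [s 0] this is [f]; from there on it lists the words [f (s 0)], [f (s 1)], ... without their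
   first letters. It is shorter than [f] at [s 0], so its badness would contradict [f_min]. *)
pose g n := if n < s 0 then f n else (p (s (n - s 0))).2.
have s_ge i : s 0 <= s i by case: i => // i; apply/ltnW/s_mono.
suff bad_g : bad g.
  have : size (f (s 0)) <= size (g (s 0)).
    by apply: f_min => // i lti; rewrite /g lti.
  by rewrite /g ltnn subnn pE /= ltnn.
move=> [i [j [ij]]]; rewrite /g.
have [js|sj] := ltnP j (s 0).
  by rewrite (ltn_trans ij js) => fij; apply: bad_f; exists i, j.
(* A good pair of [g] becomes one of [f]: in the mixed case the first letter of the later word is
   put back, otherwise both first letters are, and [Rs] compares them. *)
have [is0|si] := ltnP i (s 0) => sub.
  apply: bad_f; exists i, (s (j - s 0)); split; first exact: leq_trans (s_ge _).
  by rewrite (pE (s _)); apply: subword_skip.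
have ltij : i - s 0 < j - s 0 by rewrite ltn_sub2r // (leq_ltn_trans si).
apply: bad_f; exists (s (i - s 0)), (s (j - s 0)); split; first exact: s_mono.
by rewrite !pE; apply: subword_cons => //; apply: Rs.
Qed.

End Higman.

(** * Finite sets and finite chains *)

Lemma pigeonhole3 (A B : finType) (f : A -> B) : #|B| * 2 < #|A| ->
  exists a1 a2 a3, [/\ a1 != a2, a2 != a3, a3 != a1, f a1 = f a2 & f a1 = f a3].
Proof.
move=> ltBA; suff [b /card_gt2P] : exists b, 2 < #|[set a | f a == b]%SET|.
  move=> [a1 [a2 [a3 [[]]]]]; rewrite !inE => /eqP f1 /eqP f2 /eqP f3 [? ? ?].
  by exists a1, a2, a3; rewrite f1 f2 f3.
apply: contrapT => /forallNP small; move: ltBA.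
rewrite ltnNge -sum_nat_const -sum1_card (partition_big f predT) //= => /negP[].
apply: leq_sum => b _; rewrite leqNgt; apply/negP => big; apply: (small b).
by rewrite -sum1_card (eq_bigl (fun a => f a == b)) // => a; rewrite inE.
Qed.

Lemma card_le_bounded (T : Type) (g : T -> nat) (n : nat) :
  injective g -> (forall x, g x < n) -> [set: T] #<= `I_n.
Proof.
move=> g_inj gn; have -> : [set: T] = g @^-1` `I_n.
  by apply/seteqP; split=> x // _; apply: gn.
by apply: card_ge_preimage => x y _ _; apply: g_inj.
Qed.

Lemma finite_set_inj (T U : Type) (g : T -> U) :
  injective g -> finite_set [set: U] -> finite_set [set: T].
Proof.
move=> g_inj; rewrite -(preimage_setT g).
by apply: finite_preimage => x y _ _; apply: g_inj.
Qed.

Lemma inj_surj_bijective (T U : Type) (g : T -> U) :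
  injective g -> (forall y, exists x, g x = y) -> bijective g.
Proof.
move=> g_inj /choice[g' gK]; exists g' => // x; apply: g_inj; exact: gK.
Qed.

(** Finiteness gives a bijection [e0] from an ordinal; sorting its indices by the pulled-back order
    makes it monotone. *)
Lemma finite_chain_enum (I : Type) (le : rel I) :
  finite_set [set: I] -> is_chain le ->
  exists (k : nat) (e : 'I_k -> I),
    bijective e /\ forall i j, le (e i) (e j) = (i <= j).
Proof.
move=> /finite_setP[k /card_bijP[g [g' gK g'K]]].
move=> [le_refl le_anti le_trans le_tot].
pose e0 (i : 'I_k) : I := sval (g' (exist _ (val i) (mem_set (ltn_ord i)))).
have e0_bij : bijective e0.
  apply: inj_surj_bijective => [i j|x].
    move=> /val_inj eij; apply/val_inj.
    by have /(congr1 val) := can_inj g'K eij.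
  pose y := g (exist _ x (in_setT x)).
  have ltyk : sval y < k by have := set_mem (svalP y).
  exists (Ordinal ltyk); rewrite /e0 /=.
  set z := exist _ _ _; have -> : z = y by apply: val_inj.
  by rewrite gK.
pose le0 : rel 'I_k := relpre e0 le.
have le0_refl : reflexive le0 by move=> i; apply: le_refl.
have le0_tot : total le0 by move=> i j; apply: le_tot.
have le0_trans : transitive le0 by move=> j i l; apply: le_trans.
pose s := sort le0 (enum 'I_k).
have size_s : size s == k by rewrite size_sort size_enum_ord.
have uniq_s : uniq s by rewrite sort_uniq enum_uniq.
pose t := Tuple size_s.
have t_bij : bijective (tnth t).
  by apply: injF_bij => i j; apply/tuple_uniqP.
exists k, (e0 \o tnth t); split; first exact: bij_comp.
have sorted_s : sorted le0 s by apply: sort_sorted.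
have le_t (i j : 'I_k) : i <= j -> le (e0 (tnth t i)) (e0 (tnth t j)).
  move=> ij; rewrite !(tnth_nth i).
  apply: (sorted_leq_nth le0_trans le0_refl i sorted_s) => //;
    by rewrite inE (eqP size_s).
move=> i j /=; apply/idP/idP => [leij|/le_t//].
rewrite leqNgt; apply/negP => ji.
have /le_anti :
    le (e0 (tnth t i)) (e0 (tnth t j)) && le (e0 (tnth t j)) (e0 (tnth t i)).
  by rewrite leij le_t // ltnW.
by move=> /(bij_inj e0_bij)/(bij_inj t_bij) eij; rewrite eij ltnn in ji.
Qed.

(** * Embeddings and lexicographical sums *)

(** Proof irrelevance turns the transport along the equality of indices into the identity. *)
Lemma existT_inj (I : Type) (T : I -> Type) (i : I) (x y : T i) :
  existT T i x = existT T i y -> x = y.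
Proof.
move=> e; move: (projT2_eq e).
by rewrite (Prop_irrelevance (projT1_eq e) erefl).
Qed.

Section Embeddings.
Variable L : Type.
Implicit Types G H K : lgraph L.

Lemma embedding_id G : embedding (@id G).
Proof. by split. Qed.

Lemma embedding_comp G H K (g : G -> H) (h : H -> K) :
  embedding g -> embedding h -> embedding (h \o g).
Proof.
move=> [g_inj gE gl] [h_inj hE hl]; split=> [|x y|x] /=.
- exact: inj_comp.
- by rewrite gE hE.
- by rewrite hl gl.
Qed.

Lemma embeds_trans H G K : embeds G H -> embeds H K -> embeds G K.
Proof. by move=> [g ?] [h ?]; exists (h \o g); apply: embedding_comp. Qed.

Lemma isomorphic_embeds G H : isomorphic G H -> embeds G H.
Proof. by move=> [h [_ ?]]; exists h. Qed.

Lemma isomorphic_sym G H : isomorphic G H -> isomorphic H G.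
Proof.
move=> [h [[g hK gK] [h_inj hE hl]]]; exists g; split; first by exists h.
split=> [|x y|x]; first exact: can_inj gK.
- by rewrite -{1}(gK x) -{1}(gK y) -hE.
- by rewrite -{2}(gK x) hl.
Qed.

Lemma isomorphic_trans H G K :
  isomorphic G H -> isomorphic H K -> isomorphic G K.
Proof.
move=> [g [? ?]] [h [? ?]]; exists (h \o g).
by split; [exact: bij_comp|exact: embedding_comp].
Qed.

Lemma isomorphic_refl G : isomorphic G G.
Proof. by exists id; split; [exists id|exact: embedding_id]. Qed.

Section Induced.
Variables (G : lgraph L) (Q : G -> Prop).

Definition induced_edge (u v : {x : G | Q x}) : Prop :=
  edge (sval u) (sval v).

Lemma induced_edge_sym u v : induced_edge u v -> induced_edge v u.
Proof. exact: edge_sym. Qed.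

Lemma induced_edge_irrefl u : ~ induced_edge u u.
Proof. exact: edge_irrefl. Qed.

Definition induced : lgraph L :=
  @LGraph L (Graph induced_edge_sym induced_edge_irrefl)
    (fun u => label (sval u)).

Lemma induced_finite : finite_graph G -> finite_graph induced.
Proof.
by apply: finite_set_inj; apply: eq_sig_hprop => x; apply: Prop_irrelevance.
Qed.

End Induced.

End Embeddings.

Section LexicographicalSums.
Variables (L : Type) (star : L -> L -> bool).
Implicit Types (G H K : lgraph L) (C : lgraph L -> Prop).

(** Adjacency between summands in terms of indices and labels alone; it is applied to distinct [i]
    and [j] only. *)
Definition cross_edge (J : Type) (le : rel J) (i j : J) (a b : L) : Prop :=
  le i j /\ star a b \/ le j i /\ star b a.

Section Sum.
Variables (I : Type) (le : rel I) (G : I -> lgraph L).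
Implicit Types u v : lexsum star le G.

Lemma lexsum_edge_fiber i (x y : G i) :
  lexsum_edge star le (existT _ i x) (existT _ i y) <-> edge x y.
Proof.
split; last exact: lexsum_in.
(* Free endpoints permit case analysis on the edge; a cross edge would have distinct indices both
   equal to [i]. *)
suff eqs u v : lexsum_edge star le u v -> forall x y : G i,
    u = existT _ i x -> v = existT _ i y -> edge x y by move/eqs; apply.
case=> [j x' y' xy|j l x' y' _ neq _|j l x' y' _ neq _] {}x {}y eu ev.
- have eij : j = i := projT1_eq eu; subst j.
  by rewrite -(existT_inj eu) -(existT_inj ev).
- by case: neq; rewrite (projT1_eq eu : j = i) (projT1_eq ev : l = i).
- by case: neq; rewrite (projT1_eq eu : l = i) (projT1_eq ev : j = i).
Qed.

Lemma lexsum_edge_cross u v : projT1 u <> projT1 v ->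
  edge u v <-> cross_edge le (projT1 u) (projT1 v) (label u) (label v).
Proof.
move=> neq; split=> [uv|].
  case: uv neq => [i x y xy|i j x y ij _ xy|i j x y ij _ xy] //= _.
    by left.
  by right.
case: u v neq => [i x] [j y] /= neq [[ij xy]|[ij xy]].
  exact: lexsum_lt.
by apply: lexsum_gt => // eji; apply: neq.
Qed.

End Sum.

Section Functoriality.
Variables (I J : Type) (le : rel I) (le' : rel J).
Variables (G : I -> lgraph L) (H : J -> lgraph L) (f : I -> J).
Hypothesis f_inj : injective f.
Hypothesis f_mono : forall i j, le' (f i) (f j) = le i j.

(** Edges inside a summand are handled by [h i]; those between summands depend on the order, which
    [f] keeps, and on labels, which [h i] keeps. *)
Lemma lexsum_embedding (h : forall i, G i -> H (f i)) :
  (forall i, embedding (h i)) ->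
  @embedding L (lexsum star le G) (lexsum star le' H)
    (fun u => existT _ (f (projT1 u)) (h _ (projT2 u))).
Proof.
move=> hP; have hl i x : label (h i x) = label x by case: (hP i).
split=> [[i x] [j y] e|[i x] [j y]|[i x]] /=; last exact: hl.
- have eij := f_inj (projT1_eq e : f i = f j); rewrite -{}eij in y e *.
  by case: (hP i) => h_inj _ _; have /= -> := h_inj _ _ (existT_inj e).
- have [eij|neq] := pselect (i = j).
    rewrite -{}eij in y *; rewrite !lexsum_edge_fiber.
    by case: (hP i).
  have cross := @lexsum_edge_cross _ le G (existT _ i x) (existT _ j y) neq.
  have cross' := @lexsum_edge_cross _ le' H (existT _ (f i) (h i x))
    (existT _ (f j) (h j y)) (fun e => neq (f_inj e)).
  apply: (iff_trans cross); apply: iff_sym; apply: (iff_trans cross').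
  by rewrite /cross_edge /= /lexsum_label /= !f_mono !hl.
Qed.

Lemma lexsum_embeds : (forall i, embeds (G i) (H (f i))) ->
  embeds (lexsum star le G) (lexsum star le' H).
Proof.
move=> emb; pose h i := sval (cid (emb i)).
by eexists; apply: (@lexsum_embedding h) => i; apply: svalP.
Qed.

End Functoriality.

Lemma lexsum_reindex (I J : Type) (le : rel I) (le' : rel J)
    (H : J -> lgraph L) (f : I -> J) :
  bijective f -> (forall i j, le' (f i) (f j) = le i j) ->
  isomorphic (lexsum star le (fun i => H (f i))) (lexsum star le' H).
Proof.
move=> f_bij f_mono; have [g fK gK] := f_bij.
have emb := @lexsum_embedding _ _ le le' (fun i => H (f i)) H f (bij_inj f_bij)
  f_mono (fun i x => x) (fun i => embedding_id (H (f i))).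
eexists; split; last exact: emb.
case: emb => h_inj _ _; apply: inj_surj_bijective => // -[j y].
by move: y; rewrite -(gK j) => y; exists (existT _ (g j) y).
Qed.

Lemma lexsum_decomposition G (J : Type) (le : rel J) (c : G -> J) :
  (forall x y, c x <> c y ->
     edge x y <-> cross_edge le (c x) (c y) (label x) (label y)) ->
  isomorphic G (lexsum star le (fun j => induced (fun x : G => c x = j))).
Proof.
move=> crossP.
pose S := lexsum star le (fun j => induced (fun x : G => c x = j)).
pose h x : S := existT _ (c x) (exist _ x erefl).
exists h; have h_inj : injective h.
  move=> x y e; pose val (u : S) : G := sval (projT2 u).
  exact: (congr1 val e).
(* Places two vertices with propositionally equal [c]-values in literally the same fibre. *)
have hE j x (e : c x = j) : h x = existT _ j (exist _ x e).
  by rewrite /h; case: _ / e.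
split; first by apply: inj_surj_bijective => // -[j [x e]]; exists x.
split=> // x y; have [exy|neq] := pselect (c x = c y); last first.
  apply: (iff_trans (crossP _ _ neq)); apply: iff_sym.
  exact: (@lexsum_edge_cross _ _ _ (h x) (h y)).
rewrite (hE _ y (esym exy)); apply: iff_sym.
exact: (@lexsum_edge_fiber J le (fun j => induced (fun x => c x = j)) (c x)
  (exist _ x erefl) (exist _ y (esym exy))).
Qed.

(** Supplies the hypothesis of [lexsum_decomposition] when [c] is the index of the summand that [h]
    reaches. *)
Lemma embedding_lexsum_cross (I : Type) (le : rel I) (H : I -> lgraph L) G
    (h : G -> lexsum star le H) : embedding h ->
  forall x y, projT1 (h x) <> projT1 (h y) -> edge x y <->
    cross_edge le (projT1 (h x)) (projT1 (h y)) (label x) (label y).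
Proof.
by move=> [_ hE hl] x y neq; rewrite hE lexsum_edge_cross // !hl.
Qed.

(** The embedding takes second components of [h], obtained by choice since their type varies. [Q]
    implies the index equation instead of being it, which covers fibres of a map into an ordinal. *)
Lemma induced_fiber_embeds (I : Type) (le : rel I) (H : I -> lgraph L) G
    (h : G -> lexsum star le H) (Q : G -> Prop) (i : I) :
  embedding h -> (forall x, Q x -> projT1 (h x) = i) ->
  embeds (induced Q) (H i).
Proof.
move=> [h_inj hE hl] Qi.
have ex (u : induced Q) : exists y : H i, h (sval u) = existT _ i y.
  case: u => x Qx /=; move: (Qi x Qx); case: (h x) => j y /= eji.
  by case: _ / eji; exists y.
have [g gP] := choice ex; exists g; split=> [u v euv|u v|u].
- apply: eq_sig_hprop => [x|]; first exact: Prop_irrelevance.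
  by apply: h_inj; rewrite !gP euv.
- rewrite -(lexsum_edge_fiber le) -!gP; exact: hE.
- by have := hl (sval u); rewrite gP.
Qed.

(** * Sums over finite chains: heredity, ages and inexhaustibility *)

Definition leq_ord k : rel 'I_k := fun i j => i <= j.

Lemma leq_ord_chain k : is_chain (@leq_ord k).
Proof.
split=> [i|i j ij|j i l|i j]; first exact: leqnn.
- by apply/val_inj/anti_leq.
- exact: leq_trans.
- exact: leq_total.
Qed.

Lemma finite_lexsumsP C G : finite_lexsums star C G <->
  exists (k : nat) (H : 'I_k -> lgraph L),
    (forall i, C (H i)) /\ isomorphic G (lexsum star (@leq_ord k) H).
Proof.
split=> [[I [le [H [finI chI CH isoG]]]]|[k [H [CH isoG]]]].
  have [k [e [e_bij e_mono]]] := finite_chain_enum finI chI.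
  exists k, (fun i => H (e i)); split=> //.
  by apply/(isomorphic_trans isoG)/isomorphic_sym/lexsum_reindex.
exists 'I_k, (@leq_ord k), H; split=> //; exact: leq_ord_chain.
Qed.

(** An induced subgraph of a sum is the sum, over the same chain, of its traces on the summands. *)
Lemma finite_lexsums_hereditary C :
  hereditary C -> hereditary (finite_lexsums star C).
Proof.
move=> herC G H [I [le [K [finI chI CK isoH]]]] embG.
have [h hP] := embeds_trans embG (isomorphic_embeds isoH).
exists I, le, (fun i => induced (fun x : G => projT1 (h x) = i)).
split=> // [i|]; last exact/lexsum_decomposition/embedding_lexsum_cross.
by apply: herC (CK i) _; apply: induced_fiber_embeds hP _.
Qed.

Lemma finite_lexsums_finite C : (forall G, C G -> finite_graph G) ->
  forall G, finite_lexsums star C G -> finite_graph G.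
Proof.
move=> finC G [I [le [H [finI _ CH [h [/bij_inj h_inj _]]]]]].
apply: finite_set_inj h_inj _.
have -> : [set: lexsum star le H] =
    \bigcup_(i in [set: I]) range (fun x : H i => existT _ i x).
  by apply/seteqP; split=> // -[i x] _; exists i => //; exists x.
by apply: bigcup_finite => // i _; apply/finite_image/finC.
Qed.

(** A sum of [k] members sits in the first [k] of the omega copies of [H]. Conversely a finite graph
    meets only copies below some [n] and is the sum of its traces on them, some possibly empty. *)
Lemma finite_lexsums_is_age C : is_age C -> is_age (finite_lexsums star C).
Proof.
move=> [H ageH]; exists (lexsum star leq (fun _ => H)) => G; split.
  move=> lexG; split.
    by apply: (@finite_lexsums_finite C _ G lexG) => K /ageH[].
  move/finite_lexsumsP: lexG => [k [K [CK isoG]]].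
  apply: embeds_trans (isomorphic_embeds isoG) _.
  apply: (@lexsum_embeds _ _ _ _ _ _ val) => [||i]; first exact: val_inj.
    by [].
  by have /ageH[] := CK i.
move=> [finG [h hP]].
have [n ltn] : exists n, forall x, projT1 (h x) < n.
  have : finite_set (range (fun x => projT1 (h x))) by apply: finite_image.
  move=> /finite_seqP[s sE]; exists (\max_(i <- s) i).+1 => x.
  rewrite ltnS; apply: leq_bigmax_seq => //.
  have : range (fun x => projT1 (h x)) (projT1 (h x)) by exists x.
  by rewrite sE.
apply/finite_lexsumsP; exists n.
pose c x : 'I_n := Ordinal (ltn x).
exists (fun i => induced (fun x => c x = i)); split=> [i|].
  apply/ageH; split; first exact: induced_finite.
  by apply: (induced_fiber_embeds hP (i := val i)) => x <-.
apply: lexsum_decomposition => x y neq.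
by apply: (embedding_lexsum_cross hP) => e; apply/neq/val_inj.
Qed.

(** Placing the first chain entirely below the second makes the two sums disjoint blocks of one
    finite sum. *)
Lemma finite_lexsums_inexhaustible C : inexhaustible (finite_lexsums star C).
Proof.
move=> G1 G2 [I1 [le1 [H1 [finI1 ch1 CH1 [g1 [_ g1P]]]]]].
move=> [I2 [le2 [H2 [finI2 ch2 CH2 [g2 [_ g2P]]]]]].
pose le (i j : I1 + I2) := match i, j with
  | inl i, inl j => le1 i j
  | inr i, inr j => le2 i j
  | inl _, inr _ => true
  | inr _, inl _ => false
  end.
pose H (i : I1 + I2) := match i with inl i => H1 i | inr i => H2 i end.
have emb1 := @lexsum_embedding _ _ le1 le H1 H inl
  (fun _ _ e => ltac:(by case: e)) (fun _ _ => erefl)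
  (fun _ x => x) (fun _ => embedding_id _).
have emb2 := @lexsum_embedding _ _ le2 le H2 H inr
  (fun _ _ e => ltac:(by case: e)) (fun _ _ => erefl)
  (fun _ x => x) (fun _ => embedding_id _).
exists (lexsum star le H).
eexists; eexists; split; last 3 first.
- exact: embedding_comp g1P emb1.
- exact: embedding_comp g2P emb2.
- by move=> x y /= /projT1_eq.
exists (I1 + I2)%type, le, H; split; last exact: isomorphic_refl.
- have -> : [set: I1 + I2] = range inl `|` range inr.
    by apply/seteqP; split=> // -[i|i] _; [left|right]; exists i.
  by rewrite finite_setU; split; apply: finite_image.
- case: ch1 ch2 => [r1 a1 t1 l1] [r2 a2 t2 l2]; split.
  + by case=> i; [exact: r1|exact: r2].
  + by case=> i [] j //= => [/a1|/a2] ->.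
  + by case=> j [] i [] l //=; solve [exact: t1|exact: t2].
  + by case=> i [] j /=.
- by case=> i; [exact: CH1|exact: CH2].
Qed.

(** * Well-quasi-ordering *)

(** In a sequence that is not good nothing embeds forwards, so the dichotomy for backward embeddings
    leaves a strictly descending subsequence or an antichain. *)
Lemma wqo_good C (u : nat -> lgraph L) : wqo C -> (forall n, C (u n)) ->
  good_seq (@embeds L) u.
Proof.
move=> [noanti nodesc] Cu; apply: contrapT => bad.
have Nemb m n : m < n -> ~ embeds (u m) (u n).
  by move=> mn emb; apply: bad; exists m, n.
have [s [s_mono [desc|anti]]] :=
  sequence_dichotomy (fun m n => embeds (u n) (u m)).
  apply: nodesc; exists (u \o s); split=> [n|n] /=; first exact: Cu.
  by split; [exact: desc|exact/Nemb/s_mono].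
apply: noanti; exists (u \o s); split=> [n|m n /eqP] /=; first exact: Cu.
by rewrite neq_ltn => /orP[/s_mono/Nemb|/anti].
Qed.

(** In a descending sequence a good pair [m < n] would embed [u m] into [u n], hence into [u m.+1],
    against strictness. *)
Lemma good_wqo C :
  (forall u : nat -> lgraph L, (forall n, C (u n)) -> good_seq (@embeds L) u) ->
  wqo C.
Proof.
move=> good; split=> -[u [/good[m [n [mn emb]]]]].
  by move=> /(_ m n _ emb); apply=> e; rewrite e ltnn in mn.
move=> desc; case: (desc m) => _; apply; apply: embeds_trans emb _.
have {mn}[d ->] : exists d, n = m.+1 + d by exists (n - m.+1); rewrite subnKC.
elim: d => [|d IHd].
  by rewrite addn0; apply/isomorphic_embeds/isomorphic_refl.
by apply: embeds_trans IHd; rewrite addnS; case: (desc (m.+1 + d)).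
Qed.

(* The letters are the pairs [(n, i)] with [i] an index of a summand of [u n],
   so that each of them denotes a member of [C]. *)
Lemma finite_lexsums_wqo C : wqo C -> wqo (finite_lexsums star C).
Proof.
move=> wqoC; apply: good_wqo => u lexu.
have ex n : exists p : {k & 'I_k -> lgraph L}, (forall i, C (projT2 p i)) /\
    isomorphic (u n) (lexsum star (@leq_ord _) (projT2 p)).
  by have /finite_lexsumsP[k [H ?]] := lexu n; exists (existT _ k H).
have [p pP] := choice ex.
pose A := {n & 'I_(projT1 (p n))}.
pose graph_of (a : A) : lgraph L := projT2 (p (projT1 a)) (projT2 a).
pose R (a b : A) := embeds (graph_of a) (graph_of b).
pose w n : seq A := [seq existT _ n i | i <- enum 'I_(projT1 (p n))].
have R_trans b a c : R a b -> R b c -> R a c by apply: embeds_trans.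
have R_good v : good_seq R v.
  apply: (wqo_good (u := graph_of \o v) wqoC) => n.
  by have [CH _] := pP (projT1 (v n)); apply: CH.
have [m [n [mn /subword_map_nth[f [f_mono fP]]]]] := higman R_trans R_good w.
exists m, n; split=> //.
have size_w l : size (w l) = projT1 (p l) by rewrite size_map size_enum_ord.
have w_nth l (x0 : A) (i : 'I_(projT1 (p l))) : nth x0 (w l) i = existT _ l i.
  by rewrite (nth_map i) ?size_enum_ord // nth_ord_enum.
have f_lt (i : 'I_(projT1 (p m))) : f i < projT1 (p n).
  by rewrite -(size_w n); case: (fP i) => //; rewrite (size_w m).
pose F i := Ordinal (f_lt i).
have [_ iso_m] := pP m; have [_ iso_n] := pP n.
apply: embeds_trans (isomorphic_embeds iso_m) _.
apply: embeds_trans (isomorphic_embeds (isomorphic_sym iso_n)).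
(* Strict growth makes [f] reflect the order as well, as [lexsum_embeds] requires. *)
have le_f : {mono f : i j / i <= j} by apply: leq_mono.
apply: (@lexsum_embeds _ _ _ _ _ _ F) => [i j /(congr1 val) /= eij|i j|i].
- exact/val_inj/(incn_inj le_f).
- exact: le_f.
- have [|_ /(_ (existT _ m i) (existT _ m i))] := fP i.
    by rewrite (size_w m).
  by rewrite (w_nth m _ i) (w_nth n _ (F i)).
Qed.

End LexicographicalSums.

(** * Lengths of paths *)

(** Edges of a direct sum stay inside a summand, so the n+1 distinct vertices all lie in that of
    [q 0], which has at most k+1. *)
Lemma dsum_walk_length (L I : Type) (P : I -> lgraph L) (k n : nat)
    (q : nat -> dsum P) :
  (forall i, length_at_most (P i) k) ->
  (forall t, t < n -> edge (q t) (q t.+1)) ->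
  (forall s t, s <= n -> t <= n -> q s = q t -> s = t) -> n <= k.
Proof.
move=> lenP edge_q q_inj.
have q_fiber t : t <= n ->
    exists y : P (projT1 (q 0)), q t = existT (fun i => P i) _ y.
  move=> tn; suff <- : projT1 (q t) = projT1 (q 0).
    by exists (projT2 (q t)); case: (q t).
  elim: t tn => // t IHt tn; rewrite -IHt; last exact: ltnW.
  by case: (edge_q t tn).
have [y yP] := choice (fun t : 'I_n.+1 => q_fiber t (ltn_ord t)).
have y_inj : injective y.
  move=> s t est; apply/val_inj/(q_inj s t (ltn_ord s) (ltn_ord t)).
  by rewrite !yP est.
have := lenP (projT1 (q 0)); rewrite /length_at_most => len.
have : [set: 'I_n.+1] #<= `I_k.+1.
  apply: card_le_trans len.
  rewrite -(preimage_setT y).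
  by apply: card_ge_preimage => s t _ _; apply: y_inj.
move=> /pcard_leP[g].
have g_lt (t : 'I_n.+1) : g t < k.+1.
  by apply: (@funS _ _ [set: 'I_n.+1] `I_k.+1 g t).
have g_inj : injective (fun t => Ordinal (g_lt t)).
  move=> s t /(congr1 val) /= est.
  by apply: (@inj _ _ [set: 'I_n.+1] g) est; rewrite inE.
by have := leq_card _ g_inj; rewrite !card_ord ltnS.
Qed.

(* The lowest of the three vertices [x_t] is below every [y_t], and adjacency
   between different summands depends on labels only. *)
Lemma lexsum_common_neighbour (L : Type) (star : L -> L -> bool) (I : Type)
    (le : rel I) (G : I -> lgraph L) (x1 x2 x3 y1 y2 y3 : lexsum star le G)
    (a b : L) :
  is_chain le -> star a b ->
  (forall x, x = x1 \/ x = x2 \/ x = x3 -> label x = a) ->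
  (forall y, y = y1 \/ y = y2 \/ y = y3 -> label y = b) ->
  le (projT1 x1) (projT1 y1) -> projT1 x1 <> projT1 y1 ->
  le (projT1 x2) (projT1 y2) -> projT1 x2 <> projT1 y2 ->
  le (projT1 x3) (projT1 y3) -> projT1 x3 <> projT1 y3 ->
  exists x, (x = x1 \/ x = x2 \/ x = x3) /\
    [/\ edge x y1, edge x y2 & edge x y3].
Proof.
move=> [le_refl le_anti le_trans le_tot] ab xa yb le1 ne1 le2 ne2 le3 ne3.
have [x [xP lex1 lex2 lex3]] : exists x, [/\ x = x1 \/ x = x2 \/ x = x3,
    le (projT1 x) (projT1 x1), le (projT1 x) (projT1 x2)
  & le (projT1 x) (projT1 x3)].
  have [le12|le21] := orP (le_tot (projT1 x1) (projT1 x2)).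
    have [le13|le31] := orP (le_tot (projT1 x1) (projT1 x3)).
      by exists x1; split=> //; left.
    exists x3; split=> //; last exact: le_trans le31 le12.
    by right; right.
  have [le23|le32] := orP (le_tot (projT1 x2) (projT1 x3)).
    by exists x2; split=> //; right; left.
  exists x3; split=> //; last exact: le_trans le32 le21.
  by right; right.
have edge_x (z y : lexsum star le G) : label y = b ->
    le (projT1 x) (projT1 z) -> le (projT1 z) (projT1 y) -> projT1 z <> projT1 y -> edge x y.
  move=> lb xz zy ne; have xy := le_trans _ _ _ xz zy.
  apply/lexsum_edge_cross; last by left; rewrite xa // lb.
  by move=> e; apply: ne; apply: le_anti; rewrite zy -e.
exists x; split=> //; split.
- by apply: (edge_x x1) => //; apply: yb; left.
- by apply: (edge_x x2) => //; apply: yb; right; left.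
- by apply: (edge_x x3) => //; apply: yb; right; right.
Qed.

(** * Walks through consecutive vertices of a path in a sum *)

Section PathLength.
Variables (L : Type) (star : L -> L -> bool).
Variables (I : Type) (le : rel I) (G : I -> lgraph L) (P : lgraph L).
Variables (h : P -> lexsum star le G) (k m : nat) (color : L -> nat).
Hypotheses (le_chain : is_chain le) (hP : embedding h).
Hypothesis G_dsum : forall i, dsum_of_paths k (G i).
Hypothesis color_lt : forall x : P, color (label x) < m.
Hypothesis color_inj :
  forall x y : P, color (label x) = color (label y) -> label x = label y.
Variables (f : P -> int) (z : int) (p : nat -> P) (n : nat).
Hypothesis edge_f : forall x y : P, edge x y <-> `|f x - f y|%R = 1%R.
Hypothesis p_walk : forall i, i <= n -> f (p i) = (z + i%:Z)%R.

Let idx i := projT1 (h (p i)).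
Let cross i := idx i <> idx i.+1.
Let up i := le (idx i) (idx i.+1).

Let edge_p i : i < n -> edge (p i) (p i.+1).
Proof. by move=> lin; apply/edge_f; rewrite !p_walk //; lia. Qed.

Let p_inj i j : i <= n -> j <= n -> p i = p j -> i = j.
Proof. by move=> lei lej /(congr1 f); rewrite !p_walk //; lia. Qed.

(** Otherwise [p i], ..., [p (i + k.+1)] lie in one summand, where their k+1 edges form a walk too
    long for [dsum_walk_length]. *)
Lemma walk_has_cross i : i + k.+1 <= n ->
  exists j, i <= j < i + k.+1 /\ cross j.
Proof.
move=> lei; apply: contrapT => /forallNP Ncross.
have same t : t <= k.+1 -> idx (i + t) = idx i.
  elim: t => [|t IHt] tk; first by rewrite addn0.
  rewrite -IHt ?(ltnW tk)// addnS; apply: contrapT => ne.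
  by apply: (Ncross (i + t)); split; [lia|move=> e; apply: ne].
have fiber t : exists x : G (idx i), t <= k.+1 ->
    h (p (i + t)) = existT (fun i => G i) _ x.
  have [tk|tk] := leqP t k.+1; last by exists (projT2 (h (p i))).
  rewrite -(same t tk); exists (projT2 (h (p (i + t)))) => _.
  by rewrite /idx; case: (h _).
have [x xP] := choice fiber.
have [J [Q [QP [g [_ [g_inj gE _]]]]]] := G_dsum (idx i).
suff : k.+1 <= k by rewrite ltnn.
apply: (@dsum_walk_length _ _ Q k k.+1 (fun t => g (x t))).
- by move=> j; case: (QP j).
- move=> t tk; apply/gE; apply/(lexsum_edge_fiber star le).
  rewrite -!xP; [|exact: tk|exact: ltnW].
  case: hP => _ hE _; apply/hE; rewrite addnS; apply: edge_p; lia.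
- move=> s t sk tk /g_inj est.
  have /p_inj : p (i + s) = p (i + t).
    by case: hP => h_inj _ _; apply: h_inj; rewrite !xP // est.
  by move=> e; apply/(@addnI i)/e; lia.
Qed.

(** Only two integers are at distance 1 from [f x]. *)
Lemma no_three_neighbours x i1 i2 i3 : i1 <= n -> i2 <= n -> i3 <= n ->
  i1 != i2 -> i2 != i3 -> i3 != i1 ->
  ~ [/\ edge x (p i1), edge x (p i2) & edge x (p i3)].
Proof.
move=> le1 le2 le3 ne12 ne23 ne31 [/edge_f + /edge_f + /edge_f].
by rewrite !p_walk //; lia.
Qed.

(** By antisymmetry a crossing edge has only one direction, so [up i] decides which half of
    [cross_edge] holds. *)
Let cross_lt i : i < n -> cross i ->
  if up i then star (label (p i)) (label (p i.+1))
  else le (idx i.+1) (idx i) && star (label (p i.+1)) (label (p i)).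
Proof.
move=> lin ci; have [le_refl le_anti _ le_tot] := le_chain.
have /(embedding_lexsum_cross hP ci) := edge_p lin.
rewrite /cross_edge -/(idx _) -/(idx _) -/(up i) => -[[-> //]|[le21 st]].
case: ifP => [u|_]; last by rewrite [le _ _]le21.
case: ci; apply: le_anti; rewrite le21 andbT; exact: u.
Qed.

Lemma no_three_crosses i1 i2 i3 : i1 < n -> i2 < n -> i3 < n ->
  i1 != i2 -> i2 != i3 -> i3 != i1 -> cross i1 -> cross i2 -> cross i3 ->
  up i1 = up i2 -> up i1 = up i3 ->
  label (p i1) = label (p i2) -> label (p i1) = label (p i3) ->
  label (p i1.+1) = label (p i2.+1) -> label (p i1.+1) = label (p i3.+1) ->
  False.
Proof.
move=> l1 l2 l3 n12 n23 n31 c1 c2 c3 u12 u13 la2 la3 lb2 lb3.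
have [_ hE hl] := hP.
have := cross_lt l1 c1; have := cross_lt l2 c2; have := cross_lt l3 c3.
rewrite -u12 -u13; case: ifP => u st3 st2 st1.
  have [x [xP [e1 e2 e3]]] := @lexsum_common_neighbour _ _ _ _ _
    (h (p i1)) (h (p i2)) (h (p i3)) (h (p i1.+1)) (h (p i2.+1)) (h (p i3.+1))
    _ _ le_chain st1 ltac:(by move=> ? [->|[->|->]]; rewrite hl)
    ltac:(by move=> ? [->|[->|->]]; rewrite hl) u c1
    ltac:(by rewrite -[le _ _]u12) c2 ltac:(by rewrite -[le _ _]u13) c3.
  (* The common neighbour is in the image of [h], so its three edges pull back to [P]. *)
  have [i xE] : exists i, x = h (p i).
    by case: xP => [->|[->|->]]; [exists i1|exists i2|exists i3].
  apply: (@no_three_neighbours (p i) i1.+1 i2.+1 i3.+1); rewrite ?eqSS //.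
  by split; apply/hE; rewrite -xE.
(* For downward edges the vertices [p i.+1] are the lower ends and the vertices [p i] the upper
   ones. *)
move: st1 st2 st3 => /andP[le1 st1] /andP[le2 _] /andP[le3 _].
have [x [xP [e1 e2 e3]]] := @lexsum_common_neighbour _ _ _ _ _
  (h (p i1.+1)) (h (p i2.+1)) (h (p i3.+1)) (h (p i1)) (h (p i2)) (h (p i3))
  _ _ le_chain st1 ltac:(by move=> ? [->|[->|->]]; rewrite hl)
  ltac:(by move=> ? [->|[->|->]]; rewrite hl)
  le1 (nesym c1) le2 (nesym c2) le3 (nesym c3).
have [i xE] : exists i, x = h (p i).
  by case: xP => [->|[->|->]]; [exists i1.+1|exists i2.+1|exists i3.+1].
apply: (@no_three_neighbours (p i) i1 i2 i3) => //; try exact: ltnW.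
by split; apply/hE; rewrite -xE.
Qed.

(** Each of [N] blocks of k+1 consecutive edges has a crossing edge. Its type, the colours of both
    ends and the direction, takes at most [m * m * 2] values; [N] is one more than twice that, so
    three blocks share a type. *)
Lemma walk_length : n < (m * m * 2 * 2).+1 * k.+1.
Proof.
set N := (m * m * 2 * 2).+1; rewrite ltnNge; apply/negP => leNn.
have blk (q : 'I_N) : q * k.+1 + k.+1 <= n.
  by apply: leq_trans leNn; rewrite -mulSnr leq_mul2r ltn_ord orbT.
have [j jP] := choice (fun q : 'I_N => walk_has_cross (blk q)).
have j_lt q : j q < n.
  by have := blk q; case: (jP q) => /andP[_ jq] _; apply: leq_trans.
have j_inj : injective j.
  move=> q r eqr; apply: val_inj => /=.
  have [/andP[q1 q2] _] := jP q; have [/andP[r1 r2] _] := jP r.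
  (* The block number is recovered as a quotient by k+1. *)
  have E (s : 'I_N) : s * k.+1 <= j s -> j s < s * k.+1 + k.+1 ->
      s = j s %/ k.+1 :> nat.
    move=> s1 s2; rewrite -(subnKC s1) divnMDl // divn_small ?addn0 //.
    by rewrite ltn_subLR.
  by rewrite (E q) // (E r) // eqr.
pose col x : 'I_m := Ordinal (color_lt x).
pose type q := (col (p (j q)), col (p (j q).+1), up (j q)).
have [|q1 [q2 [q3 [n12 n23 n31]]]] :=
    @pigeonhole3 'I_N ('I_m * 'I_m * bool)%type type.
  by rewrite !card_prod !card_ord card_bool.
move=> [a12 b12 u12] [a13 b13 u13].
have [_ c1] := jP q1; have [_ c2] := jP q2; have [_ c3] := jP q3.
by apply: (no_three_crosses (j_lt q1) (j_lt q2) (j_lt q3)) => //;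
  rewrite ?(inj_eq j_inj) //; apply: color_inj.
Qed.

End PathLength.

(** * From walks to the length of a path *)

Lemma itv_walk (J : interval int) (x y : int) (i : nat) :
  x \in J -> y \in J -> (x + i%:Z <= y)%R -> (x + i%:Z)%R \in J.
Proof.
case: J => l u; rewrite !itv_boundlr => /andP[lx _] /andP[_ yu] xiy.
apply/andP; split.
  by apply: le_trans lx _; rewrite bnd_simp lerDl.
by apply: le_trans _ yu; rewrite bnd_simp.
Qed.

(** Relative to a base vertex [x0] all coordinates lie strictly between -N and N; adding N makes
    them naturals below 2N. The factor 2 appears because [x0] may lie anywhere. *)
Lemma path_length_bound (P : graph) (f : P -> int) (N : nat) :
  injective f ->
  (forall x y, (f y <= f x)%R -> (f x - f y < N%:Z)%R) ->
  length_at_most P (N * 2).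
Proof.
move=> f_inj fN; have [[x0 _]|noP] := pselect (exists x : P, True); last first.
  by apply: (@card_le_bounded _ (fun _ => 0)) => // x; case: noP; exists x.
have fN' x : (- N%:Z < f x - f x0 < N%:Z)%R.
  by have := fN x x0; have := fN x0 x; lia.
apply: (@card_le_bounded _ (fun x => absz (f x - f x0 + N%:Z)%R)) => [x y e|x].
  by apply: f_inj; move: (fN' x) (fN' y) e; lia.
by have := fN' x; lia.
Qed.

Lemma finite_lexsums_path_length (L : Type) (star : L -> L -> bool)
    (C : lgraph L -> Prop) (k : nat) :
  finite_set (labels_of C) -> (forall G, C G -> dsum_of_paths k G) ->
  exists N, forall P : lgraph L,
    finite_lexsums star C P -> is_path P -> length_at_most P N.
Proof.
(* [color] numbers all labels of [C] before [P] is given, so one bound serves every path. *)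
move=> /finite_set_leP[m /pcard_leP[color]] Ck.
exists ((m * m * 2 * 2).+1 * k.+1 * 2) => P.
move=> [I [le [G [_ chI CG [h [_ hP]]]]]] [J [f [f_inj fJ edge_f]]].
have labP (x : P) : labels_of C (label x).
  exists (G (projT1 (h x))), (projT2 (h x)); split=> //.
  by case: hP => _ _ /(_ x).
apply: (path_length_bound f_inj) => x y yx.
have inJ v : f v \in J by have : range f (f v) by [exists v]; rewrite fJ.
pose n := absz (f x - f y)%R.
(* The image of [f] is an interval, so every integer from [f y] to [f x] is the coordinate of a
   vertex; beyond [n] the value [x] is a dummy. *)
have walk i : exists v : P, i <= n -> f v = (f y + i%:Z)%R.
  have [lin|_] := leqP i n; last by exists x.
  have iJ : (f y + i%:Z)%R \in J.
    by apply: (@itv_walk J _ (f x)) => //; rewrite /n in lin; lia.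
  have : [set` J] (f y + i%:Z)%R by [].
  by rewrite -fJ => -[v _ fv]; exists v.
have [p pP] := choice walk.
suff : n < (m * m * 2 * 2).+1 * k.+1 by rewrite /n; lia.
apply: (@walk_length _ _ _ _ _ _ h k m color chI hP _ _ _ f (f y) p n) => //.
- by move=> i; apply: Ck.
- by move=> v; apply: (@funS _ _ _ _ color).
- by move=> v w; apply: (@inj _ _ (labels_of C) color); rewrite inE.
Qed.

Theorem theorem8 (L : Type) (star : L -> L -> bool) (C : lgraph L -> Prop) :
  [/\ (forall G : lgraph L, C G -> finite_graph G) -> hereditary C ->
        hereditary (finite_lexsums star C),
      is_age C -> inexhaustible C ->
        is_age (finite_lexsums star C) /\ inexhaustible (finite_lexsums star C),
      wqo C -> wqo (finite_lexsums star C)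
    & finite_set (labels_of C) ->
      (exists k : nat, forall G : lgraph L, C G -> dsum_of_paths k G) ->
      exists N : nat, forall P : lgraph L,
        finite_lexsums star C P -> is_path P -> length_at_most P N].
Proof.
split.
- by move=> _; apply: finite_lexsums_hereditary.
- move=> ageC _; split; first exact: finite_lexsums_is_age.
  exact: finite_lexsums_inexhaustible.
- exact: finite_lexsums_wqo.
- by move=> finL [k Ck]; apply: finite_lexsums_path_length finL Ck.
Qed.
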